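(* We have $b_{\mathrm{path}}(r)=\Omega(r\log r)$; that is, there is an absolute constant $c>0$ such that $b_{\mathrm{path}}(r)\ge c\,r\log r$ for every sufficiently large integer $r$.
   Context: A balanced complete bipartite graph is $K_{n,n}$ for some $n$; it is $r$-edge-coloured if each edge is assigned one of $r$ colours (not necessarily properly, and not all colours need be used). A monochromatic path is a path all of whose edges have the same colour; a single vertex counts as a (trivial) monochromatic path. For $r\ge2$, $b_{\mathrm{path}}(r)$ denotes the minimum number of vertex-disjoint monochromatic paths needed to partition the vertex set of any $r$-edge-coloured balanced complete bipartite graph, i.e. the smallest integer $b$ such that the vertex set of every $r$-edge-coloured $K_{n,n}$ (for every $n$) can be partitioned into the vertex sets of at most $b$ monochromatic paths. (This number is known to be finite.) *)

(* Defs.v *)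
From HB Require Import structures.
From mathcomp Require Import all_boot all_order all_algebra.

Set Implicit Arguments.
Unset Strict Implicit.
Unset Printing Implicit Defensive.

(* Vertices of K_{n,n}: the two sides are the two summands. *)
Definition Knn (n : nat) : finType := ('I_n + 'I_n)%type.

(* An edge joins some [inl i] to some [inr j], so an r-edge-colouring is a
   function of (i, j); it need be neither proper nor surjective. *)
Definition edge_colouring (n r : nat) : Type := 'I_n -> 'I_n -> 'I_r.

Definition colour_edge (n r : nat) (c : edge_colouring n r) (k : 'I_r) :
    rel (Knn n) :=
  fun u v => match u, v with
             | inl i, inr j => c i j == k
             | inr j, inl i => c i j == k
             | _, _ => false
             end.

(* [sorted e p] says that consecutive vertices of p are e-related; it holds
   for one-vertex sequences, which are thus (trivial) monochromatic paths. *)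
Definition mono_path (n r : nat) (c : edge_colouring n r) (p : seq (Knn n)) :
    bool :=
  [&& p != [::], uniq p & [exists k : 'I_r, sorted (colour_edge c k) p]].

Definition mono_path_partition (n r : nat) (c : edge_colouring n r)
    (P : {set {set Knn n}}) : Prop :=
  partition P [set: Knn n] /\
  forall B : {set Knn n}, B \in P ->
    exists2 p : seq (Knn n), mono_path c p & B = [set v in p].

Definition path_partitionable (r b : nat) : Prop :=
  forall (n : nat) (c : edge_colouring n r),
    exists2 P : {set {set Knn n}}, mono_path_partition c P & #|P| <= b.

From mathcomp Require Import all_classical all_reals all_analysis.

(* The infimum is the least b with [path_partitionable r b]. It is taken in
   \bar R so that the definition does not presuppose the (known) finiteness:
   it would be +oo, and not some junk natural number, if no such b existed. *)
Definition b_path (R : realType) (r : nat) : \bar R :=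
  ereal_inf [set (b%:R)%:E | b in [set b : nat | path_partitionable r b]%classic]%classic.

(* Main.v *)
Require Import Defs.
From mathcomp Require Import all_boot all_order all_algebra.
From mathcomp Require Import all_classical all_reals all_analysis.
From mathcomp Require Import fintype finset ring lra zify.

(** The lower bound comes from one explicit colouring.  Let p = r./2, so that a
    partial choice of fewer than p distinct colours always leaves at least half
    of the r colours free.  The left side consists of p blocks of equal size D;
    every right vertex j carries an injective p-tuple [f j] of colours, and all
    its edges to block i get the colour [tnth (f j) i].  Each of the
    D = r ^_ p injective tuples is carried by exactly p right vertices, so the
    two sides have the same size p * D.

    Injectivity of [f j] says that j sees each colour in at most one block.
    Hence a monochromatic path stays in one block i on the left, and, if k is
    its colour, it meets on the right only vertices with [tnth (f j) i = k]
    ([mono_path_piece]).  A partition into b paths therefore uses at most b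
    pairs (block, colour).

    Call a block saturated if more than r/4 colours are used at it; there are at
    most 4b/r such blocks.  A path alternates between the sides, so the paths
    at saturated blocks cover at most (4b/r) D + b right vertices
    ([card_avoiding_columns]).  All the other right vertices must have a colour
    that is used at some unsaturated block i as their i-th colour.  But choosing
    the entries of an injective tuple one by one shows that a fraction of at
    least exp(-4b/r) of the right vertices avoids all these colours
    ([card_avoiding_tuples_ge]).

    With x = b/r this gives p exp(-4x) <= 5x, which forces x to be at least a
    constant times log r ([nlogn_le]). *)

Set Implicit Arguments.
Unset Strict Implicit.
Unset Printing Implicit Defensive.

Import Order.TTheory GRing.Theory Num.Theory.

(** * Injective tuples with forbidden entries *)

Definition avoiding_tuples (T : finType) p (F : 'I_p -> {set T}) :
    {set p.-tuple T} :=
  [set t : p.-tuple T | uniq t & [forall i, tnth t i \notin F i]].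

(** Any admissible choice of the last p entries can be completed by a first
    entry outside [F ord0] and outside the p values already taken. *)
Lemma card_avoiding_tuplesS (T : finType) p (F : 'I_p.+1 -> {set T}) :
  #|avoiding_tuples (fun i => F (lift ord0 i))| * (#|T| - p - #|F ord0|) <=
  #|avoiding_tuples F|.
Proof.
set F' := fun i => _.
pose free (t : p.-tuple T) := ~: (F ord0 :|: [set x in t]).
pose ext (u : p.-tuple T * T) : p.+1.-tuple T := [tuple of u.2 :: u.1].
pose E := [set u | (u.1 \in avoiding_tuples F') && (u.2 \in free u.1)].
have ext_inj : injective ext.
  move=> [t x] [t' x'] /(congr1 val) /= [-> tt'].
  by congr pair; apply: val_inj.
have extE : ext @: E \subset avoiding_tuples F.
  apply/subsetP => _ /imsetP[[t x] /[!inE]/= /andP[/andP[ut /forallP tF]] xF ->].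
  move: xF; rewrite negb_or => /andP[xF xt]; rewrite /ext /= xt ut /=.
  apply/forallP => i; case: (unliftP ord0 i) => [j ->|-> //].
  by rewrite tnthS; exact: tF.
apply: leq_trans (subset_leq_card extE); rewrite card_imset //.
have -> : #|E| = \sum_(t in avoiding_tuples F') #|free t|.
  rewrite -sum1_card /=.
  under [RHS]eq_bigr do rewrite -sum1_card.
  rewrite pair_big_dep /=; apply: eq_bigl => -[t x]; by rewrite inE.
rewrite -sum_nat_const; apply: leq_sum => t _.
rewrite /free [leqRHS]cardsCs setCK -subnDA leq_sub2l //.
apply: leq_trans (leq_card_setU _ _) _; rewrite addnC leq_add2r.
by rewrite cardsE (leq_trans (card_size _)) // size_tuple.
Qed.

(** Equivalent to 1 / (1 - y) = 1 + y / (1 - y) <= 1 + 2y <= exp(2y). *)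
Lemma expRN_le_onem (R : realType) (y : R) :
  (0 <= y -> y <= 2^-1 -> expR (- (2 * y)) <= 1 - y)%R.
Proof.
move=> y0 y2; have := expR_ge1Dx (2 * y)%R.
rewrite expRN => h; rewrite -[leLHS]mulr1 ler_pdivrMl ?expR_gt0 //.
apply: le_trans (ler_wpM2r _ h); nra.
Qed.

(** When an entry is chosen, q >= #|T|/2 values are still unused, and at most
    a <= #|T|/4 of these are forbidden, so the proportion of forbidden values is
    y = a/q <= 1/2.  Avoiding them costs a factor 1 - y >= exp(-2y) >=
    exp(-4a/#|T|), and these factors multiply to the exponential of a sum, in
    which only the total size of the forbidden sets matters. *)
Lemma card_avoiding_tuples_ge (R : realType) (T : finType) p
    (F : 'I_p -> {set T}) :
  0 < #|T| -> 2 * p <= #|T| -> (forall i, 4 * #|F i| <= #|T|) ->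
  ((#|T| ^_ p)%:R * expR (- (4 * (\sum_i #|F i|)%:R / #|T|%:R)) <=
   #|avoiding_tuples F|%:R :> R)%R.
Proof.
move=> T0; elim: p F => [|p IH] F pT FT.
  rewrite big_ord0 mulr0 mul0r oppr0 expR0 mulr1 ffactn0 ler1n card_gt0.
  apply/set0Pn; exists [tuple]; rewrite inE /=; apply/forallP; by case.
have := card_avoiding_tuplesS F; rewrite -(ler_nat R); apply: le_trans.
have pT' : p <= #|T| by lia.
have FT' : #|F ord0| <= #|T| - p by have := FT ord0; lia.
rewrite big_ord_recl ffactnSr !natrM !natrD.
set s : R := (\sum_i _)%:R%R.
rewrite mulrDr mulrDl opprD addrC expRD mulrACA.
apply: ler_pM; rewrite ?mulr_ge0 ?expR_ge0 ?ler0n //.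
  by apply: IH => [|i]; [lia|exact: FT].
rewrite (natrB _ FT').
have q0 : (0 < (#|T| - p)%:R :> R)%R by rewrite ltr0n; lia.
set q : R := (#|T| - p)%:R%R; set a : R := #|F ord0|%:R%R.
have a0 : (0 <= a)%R by exact: ler0n.
have tq : (#|T|%:R <= 2 * q)%R by rewrite -natrM ler_nat; lia.
have at4 : (4 * a <= #|T|%:R)%R by rewrite -natrM ler_nat.
have t0 : (0 < #|T|%:R :> R)%R by rewrite ltr0n.
have -> : (q - a = q * (1 - a / q))%R by field; rewrite gt_eqF.
rewrite ler_pM2l //; apply: le_trans (expRN_le_onem _ _).
- rewrite ler_expR lerN2 mulrA ler_pdivrMr // -[leRHS]mulrAC ler_pdivlMr //.
  nra.
- by rewrite divr_ge0 // ltW.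
- rewrite ler_pdivrMr //; lra.
Qed.

(** * Monochromatic paths in a block colouring *)

Section BlockColouring.
Variables (n p r : nat) (blk : 'I_n -> 'I_p) (f : 'I_n -> p.-tuple 'I_r).
Hypothesis uniq_f : forall j, uniq (f j).

Definition block_colouring : edge_colouring n r := fun i j => tnth (f j) (blk i).

(** This is the vertex set of the component of colour k that contains block b. *)
Definition in_piece (b : 'I_p) (k : 'I_r) (v : Knn n) : bool :=
  match v with inl i => blk i == b | inr j => tnth (f j) b == k end.

(** From right to left this is where injectivity of the columns is used: the two
    ends of a k-coloured edge determine the block. *)
Lemma in_piece_edge b k u v :
  colour_edge block_colouring k u v -> in_piece b k u -> in_piece b k v.
Proof.
case: u v => [i|j] [i'|j'] //=; rewrite /block_colouring.
  by move=> h /eqP <-.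
by move=> /eqP<- /eqP h; apply/eqP/(tuple_uniqP _ (uniq_f j)); rewrite h.
Qed.

Lemma in_piece_path b k u s :
  path (colour_edge block_colouring k) u s -> in_piece b k u ->
  all (in_piece b k) s.
Proof.
elim: s u => //= v s IH u /andP[uv vs] bu.
have bv := in_piece_edge uv bu; by rewrite bv (IH v).
Qed.

(** The block of the first left vertex determines the piece.  A path that is a
    single right vertex has no block; it can be put in the piece of any block
    [b0] by replacing its colour with the one that the vertex has at [b0], and
    this keeps such paths from being an exceptional case in the counting. *)
Lemma mono_path_piece (b0 : 'I_p) s :
  Defs.mono_path block_colouring s -> exists u, all (in_piece u.1 u.2) s.
Proof.
case: s => // v s /and3P[_ _ /existsP[k /= vs]].
case: v vs => [i|j] vs.
  by exists (blk i, k); rewrite /= eqxx; apply: in_piece_path vs _ => /=.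
case: s vs => [_|[i|//] s /= /andP[ij vs]].
  by exists (b0, tnth (f j) b0); rewrite /= eqxx.
by exists (blk i, k); rewrite /= ij eqxx; apply: in_piece_path vs _ => /=.
Qed.

End BlockColouring.

(** * Counting vertices along paths and over partitions *)

Definition is_left n (v : Knn n) := if v is inl _ then true else false.

Lemma card_preim_uniq (I V : finType) (e : I -> V) (a : pred V) (s : seq V) :
  injective e -> (forall i, a (e i)) -> (forall v, a v -> exists i, v = e i) ->
  uniq s -> #|[set i | e i \in s]| = count a s.
Proof.
move=> e_inj ae eP us.
rewrite -size_filter -(card_uniqP (filter_uniq a us)) -(card_imset _ e_inj).
apply: eq_card => v; rewrite mem_filter; apply/imsetP/andP.
  by move=> [i /[!inE] si ->].
by move=> [/eP[i ->] si]; exists i; rewrite ?inE.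
Qed.

Lemma mono_path_balance n r (c : edge_colouring n r) s :
  Defs.mono_path c s ->
  #|[set j | inr j \in s]| <= #|[set i | inl i \in s]|.+1.
Proof.
case/and3P => _ us /existsP[k].
rewrite (@card_preim_uniq _ _ inl (@is_left n)) //; first last.
- by case=> // i _; exists i.
- by move=> i j [].
rewrite (@card_preim_uniq _ _ inr (predC (@is_left n))) //; first last.
- by case=> // i _; exists i.
- by move=> i j [].
case: s {us} => // v s /= vs.
(* Generalizing over the first vertex makes the induction go through: the
   tail has an excess of right vertices only if the head is on the left. *)
suff : count (predC (@is_left n)) s <= count (@is_left n) s + is_left v.
  by case: v {vs} => ? /=; lia.
elim: s v vs => //= w s IH v /andP[vw /IH].
by case: v w vw => [i|j] [i'|j'] //= _; lia.
Qed.

Lemma card_partition_preim (I V : finType) (P : {set {set V}}) (e : I -> V)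
    (A : {set I}) :
  partition P [set: V] -> #|A| = \sum_(B in P) #|[set x in A | e x \in B]|.
Proof.
move=> /and3P[/eqP covP tP _].
rewrite -sum1_card (partition_big (fun x => pblock P (e x)) (mem P)) /=.
  apply: eq_bigr => B BP; rewrite sum1dep_card; apply: eq_card => x.
  rewrite !inE; congr andb; apply/eqP/idP => [<-|eB]; last exact: def_pblock.
  by rewrite mem_pblock covP inE.
by move=> x _; apply: pblock_mem; rewrite covP inE.
Qed.

Lemma sum_card_slices (I J : finType) (K : {set I * J}) :
  \sum_i #|[set j | (i, j) \in K]| = #|K|.
Proof.
under eq_bigr do rewrite -sum1dep_card.
by rewrite pair_big_dep -sum1_card; apply: eq_bigl => -[i j].
Qed.

(** * The paths at saturated blocks *)

Section Accounting.
Variables (n p r D : nat) (blk : 'I_n -> 'I_p) (f : 'I_n -> p.-tuple 'I_r).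
Hypothesis uniq_f : forall j, uniq (f j).
Hypothesis card_blk : forall b, #|[set i | blk i == b]| = D.

(** [F i] is the set of colours used at block i, emptied at the saturated blocks
    [I].  A column that avoids [F] can only lie on a path at a saturated block;
    these paths cover no left vertex outside the blocks in [I], and at most one
    right vertex more than left vertices each. *)
Lemma card_avoiding_columns (u0 : 'I_p * 'I_r) (P : {set {set Knn n}}) :
  mono_path_partition (block_colouring blk f) P ->
  exists (F : 'I_p -> {set 'I_r}) (I : {set 'I_p}),
  [/\ forall i, 4 * #|F i| <= r, \sum_i #|F i| <= #|P|, r * #|I| <= 4 * #|P| &
      #|[set j | f j \in avoiding_tuples F]| <= #|I| * D + #|P|].
Proof.
move=> [partP pathP].
have /choice[g gP] : forall B : {set Knn n}, exists u : 'I_p * 'I_r, B \in P ->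
    forall v, v \in B -> in_piece blk f u.1 u.2 v.
  move=> B; have [BP|_] := boolP (B \in P); last by exists u0.
  have [s sB ->] := pathP _ BP.
  have [u /allP us] := mono_path_piece uniq_f u0.1 sB.
  by exists u => _ v /[!inE]; exact: us.
pose K := g @: P.
pose Ki i := [set k | (i, k) \in K].
pose I := [set i | r < 4 * #|Ki i|].
have KP : \sum_i #|Ki i| <= #|P| by rewrite sum_card_slices leq_imset_card.
exists (fun i => if i \in I then set0 else Ki i), I; split.
- by move=> i; rewrite inE; case: ltnP; rewrite ?cards0.
- apply: leq_trans KP; apply: leq_sum => i _; by case: ifP; rewrite ?cards0.
- rewrite (leq_trans _ (leq_mul (leqnn 4) KP)) // mulnC big_distrr /=.
  rewrite -sum_nat_const [leqRHS](bigID (mem I)) /= -[leqLHS]addn0 leq_add //.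
  by apply: leq_sum => i /[!inE] /ltnW.
set J := [set j | _].
have <- : #|[set i | blk i \in I]| = #|I| * D.
  rewrite -sum1_card (partition_big blk (mem I)) /= => [|i /[!inE] //].
  rewrite -sum_nat_const; apply: eq_bigr => b bI; rewrite -(card_blk b).
  rewrite sum1dep_card; apply: eq_card => i; rewrite !inE andb_idl //.
  by move=> /eqP ->; move: bI; rewrite inE.
rewrite (card_partition_preim inr J partP).
rewrite (card_partition_preim inl [set i | blk i \in I] partP).
rewrite -[#|P|]sum1_card -big_split /=; apply: leq_sum => B BP.
have [gI|gI] := boolP ((g B).1 \in I).
  have [s sB Bs] := pathP _ BP; have := mono_path_balance sB.
  rewrite addn1 => h; apply: leq_trans (leq_trans h _).
    apply: subset_leq_card; apply/subsetP => j.
    by rewrite Bs !inE => /andP[].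
  rewrite ltnS; apply: subset_leq_card; apply/subsetP => i.
  rewrite 2!inE => si.
  have iB : inl i \in B by rewrite Bs inE.
  by move: gI; rewrite !in_set iB andbT (eqP (gP _ BP _ iB)).
rewrite [X in X <= _](_ : _ = 0) //; apply/eqP; rewrite cards_eq0.
apply/eqP/setP => j; rewrite in_set0 in_set; apply/negP => /andP[jJ jB].
move: jJ; rewrite 2!inE => /andP[_ /forallP/(_ (g B).1)].
rewrite (negPf gI) inE => /negP; apply.
have /eqP -> := gP _ BP _ jB.
by apply/imsetP; exists B => //; case: (g B).
Qed.
End Accounting.

(** * From the counting inequality to r log r *)

(** With x = b/r, the counting inequality becomes p <= 5 x exp(4x), hence
    r <= 15 exp(5x).  Squaring and cancelling one factor r >= 225 = 15^2
    removes the constant and leaves r <= exp(10x). *)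
Lemma nlogn_le (R : realType) (r p b D G I S : nat) :
  225 <= r -> r <= 3 * p -> r <= D -> r * I <= 4 * b -> S <= b ->
  p * G <= I * D + b ->
  (D%:R * expR (- (4 * S%:R / r%:R)) <= G%:R :> R)%R ->
  (10^-1 * (r%:R * ln r%:R) <= b%:R :> R)%R.
Proof.
move=> r225 r3p rD rI Sb pG DG.
have r0 : (0 < r%:R :> R)%R by rewrite ltr0n; lia.
have D0 : (0 < D%:R :> R)%R by rewrite ltr0n; lia.
have rD' : (r%:R <= D%:R :> R)%R by rewrite ler_nat.
have r225' : (225 <= r%:R :> R)%R by rewrite ler_nat.
have rp' : (r%:R <= 3 * p%:R :> R)%R by rewrite -natrM ler_nat.
set x : R := (b%:R / r%:R)%R.
have x0 : (0 <= x)%R by rewrite divr_ge0.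
have bx : (b%:R = x * r%:R)%R by rewrite divfK // gt_eqF.
have Ix : (I%:R <= 4 * x)%R.
  by rewrite -(ler_pM2l r0) mulrCA [(r%:R * x)%R]mulrC -bx -!natrM ler_nat.
have pG' : (p%:R * G%:R <= 5 * x * D%:R)%R.
  apply: (@le_trans _ _ (I%:R * D%:R + b%:R)%R).
    by rewrite -!natrM -natrD ler_nat.
  rewrite bx; have : (I%:R * D%:R <= 4 * x * D%:R)%R by rewrite ler_pM2r.
  have : (x * r%:R <= x * D%:R)%R by exact: ler_wpM2l.
  lra.
have E4 : (D%:R * expR (- (4 * x)) <= G%:R)%R.
  apply: le_trans DG; rewrite ler_pM2l // ler_expR lerN2 -mulrA ler_pM2l //.
  by rewrite ler_pM2r ?invr_gt0 // ler_nat.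
have pE : (p%:R <= 5 * x * expR (4 * x))%R.
  have := le_trans (ler_wpM2l (ler0n R p) E4) pG'.
  rewrite mulrCA mulrC ler_pM2r // expRN.
  by rewrite ler_pdivrMr ?expR_gt0.
have rE : (r%:R <= 15 * expR (5 * x))%R.
  have -> : (5 * x = x + 4 * x)%R by ring.
  rewrite expRD.
  have : (x * expR (4 * x) <= expR x * expR (4 * x))%R.
    by rewrite ler_pM2r ?expR_gt0 //; have := expR_ge1Dx x; lra.
  lra.
have rE2 : (r%:R <= expR (10 * x))%R.
  have -> : (10 * x = 5 * x + 5 * x)%R by ring.
  rewrite expRD; set e := expR _ in rE *.
  have e0 : (0 < e)%R by exact: expR_gt0.
  nra.
have lnr : (ln r%:R <= 10 * x)%R.
  by rewrite -[leRHS]expRK ler_ln // ?posrE ?expR_gt0.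
rewrite bx [(x * _)%R]mulrC mulrCA ler_pM2l //; lra.
Qed.

(** Both sides are indexed by pairs (a, t) of a number a < p and an injective
    p-tuple t of colours: on the left only a matters for the colouring, on the
    right only t.  Using the same index type twice makes the bipartite graph
    balanced. *)
Lemma path_partitionable_ge (R : realType) (r b : nat) :
  225 <= r -> path_partitionable r b ->
  (10^-1 * (r%:R * ln r%:R) <= b%:R :> R)%R.
Proof.
move=> r225; pose p := r./2.
have r0 : 0 < r by lia.
have p0 : 0 < p by lia.
pose Inj := {t : p.-tuple 'I_r | uniq t}.
pose V : finType := ('I_p * Inj)%type.
pose blk (i : 'I_#|V|) := (enum_val i).1.
pose f (j : 'I_#|V|) := val (enum_val j).2.
have cardInj : #|{: Inj}| = r ^_ p.
  rewrite card_sig -[r in RHS]card_ord -card_uniq_tuples; apply: eq_card => t.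
  by rewrite !inE (_ : all _ t) //; apply/allP.
have uniq_f j : uniq (f j) := valP (enum_val j).2.
have card_V (A : pred V) : #|[set i : 'I_#|V| | A (enum_val i)]| = #|A|.
  rewrite -(card_imset _ enum_val_inj); apply: eq_card => v.
  apply/imsetP/idP => [[i /[!inE] Ai ->//]|Av].
  by exists (enum_rank v); rewrite ?inE enum_rankK.
have card_blk a : #|[set i | blk i == a]| = r ^_ p.
  rewrite (card_V (fun v => v.1 == a)) -cardInj.
  rewrite -[RHS]mul1n -(card1 a) -cardX; apply: eq_card => -[x y].
  by rewrite !inE andbT.
move=> /(_ _ (block_colouring blk f))[P PP Pb].
have [F [I [F4 FP IP]]] := card_avoiding_columns uniq_f card_blk (Ordinal p0, Ordinal r0) PP.
have -> : #|[set j | f j \in avoiding_tuples F]| = p * #|avoiding_tuples F|.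
  rewrite (card_V (fun v => val v.2 \in avoiding_tuples F)).
  have -> : #|avoiding_tuples F| = #|[pred y : Inj | val y \in avoiding_tuples F]|.
    rewrite -(card_imset _ (@val_inj _ _ Inj)); apply: eq_card => t.
    apply/idP/imsetP => [tF|[y /[!inE] yF -> //]].
    have ut : uniq t by move: tF; rewrite inE => /andP[].
    by exists (exist _ t ut).
  rewrite -[X in X * _]card_ord -cardX; apply: eq_card => -[x y].
  by rewrite !inE.
move=> count.
have D_ge : r <= r ^_ p.
  have := ffactnS r p.-1; rewrite prednK // => ->.
  by rewrite leq_pmulr // ffact_gt0; lia.
have := @card_avoiding_tuples_ge R _ _ F; rewrite !card_ord => avoid.
have {avoid} avoid := avoid _ _ F4.
apply: le_trans (_ : #|P|%:R <= _)%R; last by rewrite ler_nat.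
apply: nlogn_le r225 _ D_ge IP FP count (avoid _ _); rewrite /p; lia.
Qed.

Theorem theorem1p5 (R : realType) :
  exists c : R, (0 < c)%R /\
  exists r0 : nat, forall r : nat, (r0 <= r)%N ->
    ((c * (r%:R * ln r%:R))%:E <= b_path R r)%E.
Proof.
exists (10^-1)%R; split; first by rewrite invr_gt0.
exists 225 => r r225; apply: le_ereal_inf_tmp => _ [b rb <-].
by rewrite lee_fin; exact: path_partitionable_ge.
Qed.
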